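(* Let $n\ge 1$, let $a_k=\sqrt{k(n+1-k)}$ for $1\le k\le n$, let $V:\{0,1,\dots,n\}\to\mathbb{R}$ be convex, and let $H=-A+V$. Let $(\psi_k)_{k=0}^n$ be the ground state of $H$. Then the sequence $\{\psi_k^2\}_{k=0}^n$ is ultra-log-concave of order $n$, i.e. $$\left(\frac{\psi_k^2}{\binom{n}{k}}\right)^2\ \ge\ \frac{\psi_{k+1}^2}{\binom{n}{k+1}}\cdot\frac{\psi_{k-1}^2}{\binom{n}{k-1}}\qquad\text{for all } 0<k<n.$$
   Context: $H=-A+V$ denotes the real symmetric $(n+1)\times(n+1)$ matrix indexed by $\{0,1,\dots,n\}$, where $V$ is the diagonal matrix with entries $V(0),\dots,V(n)$ and $A$ is the matrix with $A_{k-1,k}=A_{k,k-1}=a_k$ for $1\le k\le n$ and all other entries $0$. Since all $a_k>0$, the lowest eigenvalue of $H$ is simple (Perron–Frobenius) and the ground state, its normalized eigenvector $(\psi_k)_{k=0}^n$, can be and is chosen with all entries $\psi_k>0$. Convexity of $V$ means $V(k+1)+V(k-1)-2V(k)\ge 0$ for all $0<k<n$. *)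

(* Defs.v *)
From mathcomp Require Export all_boot all_order all_algebra reals.

Set Implicit Arguments.
Unset Strict Implicit.
Unset Printing Implicit Defensive.

Import Order.TTheory GRing.Theory Num.Theory.
Local Open Scope ring_scope.

(* Only the values a k with 1 <= k <= n are used. *)
Definition hopping_mx (R : realType) (n : nat) (a : nat -> R) : 'M[R]_n.+1 :=
  \matrix_(i < n.+1, j < n.+1)
    if j == i.+1 :> nat then a j
    else if i == j.+1 :> nat then a i
    else 0.

Definition hamiltonian (R : realType) (n : nat) (a : nat -> R)
    (V : 'I_n.+1 -> R) : 'M[R]_n.+1 :=
  - hopping_mx n a + diag_mx (\row_k V k).

(* For 1 <= k <= n the truncated subtraction below is the usual one. *)
Definition hypercube_hopping (R : realType) (n k : nat) : R :=
  Num.sqrt (k * (n.+1 - k))%:R.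

(* In both definitions below 0 < k < n, so that inord is applied only to
   numbers at most n, where it is the identity on values. *)
Definition convex_seq (R : realType) (n : nat) (V : 'I_n.+1 -> R) : Prop :=
  forall k : nat, (0 < k < n)%N ->
    0 <= V (inord k.+1) + V (inord k.-1) - 2 * V (inord k).

Definition ultra_log_concave (R : realType) (n : nat) (x : 'I_n.+1 -> R) : Prop :=
  forall k : nat, (0 < k < n)%N ->
    (x (inord k.+1) / 'C(n, k.+1)%:R) * (x (inord k.-1) / 'C(n, k.-1)%:R)
      <= (x (inord k) / 'C(n, k)%:R) ^+ 2.

Definition lowest_eigenvalue (R : realType) (m : nat) (H : 'M[R]_m) (lam : R) : Prop :=
  eigenvalue H lam /\ forall mu : R, eigenvalue H mu -> lam <= mu.

(* eigenvalue and eigenspace refer to row vectors (psi *m H = lam *: psi); this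
   agrees with the column convention because H is meant to be symmetric. *)
Definition ground_state (R : realType) (m : nat) (H : 'M[R]_m) (psi : 'rV[R]_m) : Prop :=
  exists lam : R,
    [/\ lowest_eigenvalue H lam,
        (psi <= eigenspace H lam)%MS,
        \sum_k psi 0 k ^+ 2 = 1 &
        forall k, 0 < psi 0 k].

(* Main.v *)
(* Put phi_k = psi_k / sqrt 'C(n, k). The eigenvalue equation becomes
   k phi_(k-1) + (n-k) phi_(k+1) = W_k phi_k with W convex, and the claim is that
   phi is log-concave. Maximise phi_x phi_y / (phi_z phi_w) over all
   x <= z, w <= y <= n with x + y = z + w. At a maximiser with x < z, w, moving
   one of x, y and one of z, w by one step in the same direction cannot increase
   the quotient. A weighted sum of the resulting inequalities reads
   W_x + W_y <= W_z + W_w, and convexity of W is the reverse inequality, so those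
   with positive weight are equalities. Hence (x+1, y, z, w+1) is again a
   maximiser, and iterating until x reaches z or w shows that the maximum is 1. *)
Require Import Defs.
From mathcomp Require Import all_boot all_order all_algebra reals.
From mathcomp Require Import zify ring lra.
Import Order.TTheory GRing.Theory Num.Theory.
Local Open Scope ring_scope.

(** Unit increments of [W] grow with the index, so each of the [i] increments from [x] on is at most
    the one [j] places further right; the induction on [i] adds them up. *)
Lemma convex_four_points (R : realFieldType) (n : nat) (W : nat -> R) :
  (forall k, (k.+2 <= n)%N -> 2 * W k.+1 <= W k.+2 + W k) ->
  forall x i j, (x + i + j <= n)%N ->
    W (x + i)%N + W (x + j)%N <= W x + W (x + i + j)%N.
Proof.
move=> cvx.
have slope x j : (x + j.+1 <= n)%N ->
    W x.+1 - W x <= W (x + j).+1 - W (x + j)%N.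
  elim: j => [|j IHj] le_n; first by rewrite addn0.
  have := cvx (x + j)%N ltac:(lia); have := IHj ltac:(lia).
  by rewrite addnS; lra.
move=> x i j; elim: i => [|i IHi] le_n; first by rewrite !addn0; lra.
have := slope (x + i)%N j ltac:(lia); have := IHi ltac:(lia).
by rewrite !addnS !addSn; lra.
Qed.

(** * Log-concavity of positive solutions of the recurrence *)

Section LogConcave.

Variables (R : realFieldType) (n : nat) (phi W : nat -> R).
Hypothesis phi_gt0 : forall k, (k <= n)%N -> 0 < phi k.
(* The out-of-range terms phi 0.-1 (k = 0) and phi n.+1 (k = n) have coefficient 0. *)
Hypothesis phi_eq : forall k, (k <= n)%N ->
  k%:R * phi k.-1 + (n%:R - k%:R) * phi k.+1 = W k * phi k.
Hypothesis W_convex : forall k, (k.+2 <= n)%N ->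
  2 * W k.+1 <= W k.+2 + W k.

(** The inner pair is left unordered, so that moves of [z] and of [w] are treated alike; [z, w <= y]
    follows from the equal sums. *)
Definition nested (x y z w : nat) : bool :=
  [&& (x <= z)%N, (x <= w)%N, (z + w == x + y)%N & (y <= n)%N].

Lemma nested_gt0 x y z w : nested x y z w ->
  0 < phi x * phi y /\ 0 < phi z * phi w.
Proof.
case/and4P=> xz xw /eqP zw yn.
by split; rewrite mulr_gt0 // phi_gt0 //; lia.
Qed.

Definition cross_maximal (x y z w : nat) : Prop :=
  nested x y z w /\ forall x' y' z' w', nested x' y' z' w' ->
    phi x' * phi y' * (phi z * phi w) <= phi x * phi y * (phi z' * phi w').

Let down k := phi k.-1 / phi k.
Let up k := phi k.+1 / phi k.

Lemma potentialE k : (k <= n)%N ->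
  W k = k%:R * down k + (n%:R - k%:R) * up k.
Proof.
move=> le_kn; have k_gt0 := phi_gt0 _ le_kn.
apply: (mulIf (lt0r_neq0 k_gt0)); rewrite -(phi_eq _ le_kn) /down /up.
by field; exact: lt0r_neq0.
Qed.

Lemma cross_maximal_step x i j :
  cross_maximal x (x + i.+1 + j.+1) (x + i.+1) (x + j.+1) ->
  cross_maximal x.+1 (x + i.+1 + j.+1) (x + i.+1) (x + j.+1).+1.
Proof.
set y := (x + i.+1 + j.+1)%N; set z := (x + i.+1)%N; set w := (x + j.+1)%N.
move=> [nest maxi].
have [ey ez ew] : [/\ y = x + i.+1 + j.+1, z = x + i.+1 & w = x + j.+1]%N by [].
have le_yn : (y <= n)%N by case/and4P: nest.
have [le_xn le_zn le_wn] : [/\ x <= n, z <= n & w <= n]%N by split; lia.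
have lt_wn : (w < n)%N by lia.
have nest_xz : nested x.+1 y z.+1 w by rewrite /nested; lia.
have nest_xw : nested x.+1 y z w.+1 by rewrite /nested; lia.
have nest_yz : nested x y.-1 z.-1 w by rewrite /nested; lia.
have nest_yw : nested x y.-1 z w.-1 by rewrite /nested; lia.
have nest_down : (0 < x)%N -> nested x.-1 y z.-1 w by rewrite /nested; lia.
have nest_up : y != n -> nested x y.+1 z w.+1 by rewrite /nested; lia.
have [x0 y0 z0 w0] : [/\ 0 < phi x, 0 < phi y, 0 < phi z & 0 < phi w].
  by split; exact: phi_gt0.
(* An outer index moves from [p] to [p'] and an inner one from [q] to [q']; [C] is the product of
   [phi] at the two indices that stay. *)
have cmp p p' q q' (C : R) : 0 < phi p -> 0 < phi q -> 0 < C ->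
    phi p' * phi q * C <= phi p * phi q' * C -> phi p' / phi p <= phi q' / phi q.
  move=> p0 q0 C0; rewrite ler_pM2r // => le_pq.
  by rewrite ler_pdivrMr // mulrAC ler_pdivlMr // [leRHS]mulrC.
have up_xz : up x <= up z.
  apply: (@cmp _ _ _ _ (phi y * phi w)); rewrite ?mulr_gt0 //.
  by have := maxi _ _ _ _ nest_xz; lra.
have up_xw : up x <= up w.
  apply: (@cmp _ _ _ _ (phi y * phi z)); rewrite ?mulr_gt0 //.
  by have := maxi _ _ _ _ nest_xw; lra.
have down_yz : down y <= down z.
  apply: (@cmp _ _ _ _ (phi x * phi w)); rewrite ?mulr_gt0 //.
  by have := maxi _ _ _ _ nest_yz; lra.
have down_yw : down y <= down w.
  apply: (@cmp _ _ _ _ (phi x * phi z)); rewrite ?mulr_gt0 //.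
  by have := maxi _ _ _ _ nest_yw; lra.
have sum_down : x%:R * (down x + down y - down z - down w) <= 0.
  case: (posnP x) => [->|x_gt0]; first by rewrite mul0r.
  rewrite mulr_ge0_le0 ?ler0n //; suff : down x <= down z by lra.
  apply: (@cmp _ _ _ _ (phi y * phi w)); rewrite ?mulr_gt0 //.
  have := maxi _ _ _ _ (nest_down x_gt0); lra.
have sum_up : (n%:R - (x%:R + i.+1%:R + j.+1%:R)) * (up x + up y - up z - up w) <= 0.
  rewrite -!natrD -ey; have [->|lt_yn] := eqVneq y n; first by rewrite subrr mul0r.
  rewrite mulr_ge0_le0 ?subr_ge0 ?ler_nat //; suff : up y <= up w by lra.
  apply: (@cmp _ _ _ _ (phi x * phi z)); rewrite ?mulr_gt0 //.
  have := maxi _ _ _ _ (nest_up lt_yn); lra.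
have sum_j : j.+1%:R * (up x + down y - up z - down w) <= 0.
  by rewrite mulr_ge0_le0 ?ler0n //; lra.
(* By [potentialE], [W x + W y - W z - W w] is the sum of the left-hand sides of [sum_down],
   [sum_up], [sum_j] and of this term. Convexity makes the total nonnegative, and the first three
   are nonpositive. *)
have sum_i : 0 <= i.+1%:R * (up x + down y - down z - up w).
  have := convex_four_points _ _ _ W_convex _ _ _ le_yn; rewrite -/y -/z -/w.
  rewrite !potentialE //.
  have -> : y%:R = x%:R + i.+1%:R + j.+1%:R :> R by rewrite -!natrD.
  have -> : z%:R = x%:R + i.+1%:R :> R by rewrite -natrD.
  have -> : w%:R = x%:R + j.+1%:R :> R by rewrite -natrD.
  move: sum_down sum_up sum_j.
  move: (x%:R) (i.+1%:R) (j.+1%:R) (n%:R : R) => X I J N.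
  move: (up x) (up y) (up z) (up w) (down x) (down y) (down z) (down w).
  move=> *; lra.
(* Since [down y <= down z], the nonnegative bracket leaves [up w <= up x]: raising [x] and [w]
   together does not lower the quotient. *)
have up_wx : up w <= up x by move: sum_i; rewrite pmulr_rge0 ?ltr0n //; lra.
have {up_wx} step : phi w.+1 * phi x <= phi x.+1 * phi w.
  by move: up_wx; rewrite /up ler_pdivrMr // mulrAC ler_pdivlMr.
split=> // x' y' z' w' nest'.
have [A0 B0] := nested_gt0 _ _ _ _ nest'.
have := maxi _ _ _ _ nest'; move: A0 B0.
set A := phi x' * phi y'; set B := phi z' * phi w' => A0 B0.
move=> le_max; rewrite -(ler_pM2r (mulr_gt0 x0 w0)).
have h1 : A * (phi z * phi w) * (phi w.+1 * phi x) <=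
          phi x * phi y * B * (phi x.+1 * phi w).
  exact: ler_pM (ltW (mulr_gt0 A0 (mulr_gt0 z0 w0)))
                (ltW (mulr_gt0 (phi_gt0 _ lt_wn) x0)) le_max step.
lra.
Qed.

(** Each step keeps the outer right end and [x + i] while [i] drops by one. Once [i] or [j] is 0,
    the outer and inner pairs coincide and the quotient is 1. *)
Lemma cross_maximal_le x i j :
  cross_maximal x (x + i + j) (x + i) (x + j) ->
  phi x * phi (x + i + j)%N <= phi (x + i)%N * phi (x + j)%N.
Proof.
elim: i x => [|i IHi] x; first by rewrite !addn0.
case: j IHi => [|j] IHi maxi; first by rewrite !addn0 mulrC.
have [nest _] := maxi.
have maxi' : cross_maximal x.+1 (x.+1 + i + j.+1) (x.+1 + i) (x.+1 + j.+1).
  by have := cross_maximal_step _ _ _ maxi; rewrite -!(addSnnS x i) -(addSn x j.+1).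
have {IHi} := IHi _ maxi'; have [_ maxi''] := maxi'.
have := maxi'' _ _ _ _ nest.
have [_ B0] := nested_gt0 _ _ _ _ nest.
have [_ C0] := nested_gt0 _ _ _ _ maxi'.1.
move=> le1 le2; rewrite -(ler_pM2r C0); apply: (le_trans le1).
by rewrite mulrC ler_pM2l.
Qed.

(** All indices are at most [n], so the maximum is over a finite type; [i = z - x] and [j = w - x]
    describe any nested quadruple. *)
Lemma exists_cross_maximal : exists x i j,
  cross_maximal x (x + i + j) (x + i) (x + j).
Proof.
pose T := ('I_n.+1 * 'I_n.+1 * ('I_n.+1 * 'I_n.+1))%type.
pose P (t : T) := nested t.1.1 t.1.2 t.2.1 t.2.2.
pose F (t : T) := phi t.1.1 * phi t.1.2 / (phi t.2.1 * phi t.2.2).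
have P0 : P ((ord0, ord0), (ord0, ord0)) by [].
case: (@Order.TotalTheory.arg_maxP _ _ _ _ P F P0).
move=> [[x y] [z w]] Pt maxt.
have /and4P[/= le_xz le_xw /eqP zw_xy le_yn] := Pt.
exists x, (z - x)%N, (w - x)%N.
have -> : (x + (z - x) + (w - x) = y)%N by lia.
rewrite !subnKC //; split=> // x' y' z' w' nest'.
have /and4P[lxz lxw /eqP e lyn] := nest'.
have hx : (x' < n.+1)%N by lia.
have hy : (y' < n.+1)%N by lia.
have hz : (z' < n.+1)%N by lia.
have hw : (w' < n.+1)%N by lia.
have := maxt ((Ordinal hx, Ordinal hy), (Ordinal hz, Ordinal hw)) nest'.
have [_ B0] := nested_gt0 _ _ _ _ Pt; have [_ B0'] := nested_gt0 _ _ _ _ nest'.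
by rewrite /F /= ler_pdivrMr // mulrAC ler_pdivlMr.
Qed.

Lemma log_concave k : (k.+2 <= n)%N -> phi k.+2 * phi k <= phi k.+1 ^+ 2.
Proof.
move=> le_kn; have [x [i [j maxi]]] := exists_cross_maximal.
have le1 := cross_maximal_le _ _ _ maxi; have [_ maxk] := maxi.
(* Log-concavity at [k.+1] says that this quadruple has quotient at most 1. *)
have /maxk : nested k k.+2 k.+1 k.+1 by apply/and4P; split=> //; lia.
have [_ B0] := nested_gt0 _ _ _ _ maxi.1.
have k0 : 0 < phi k.+1 by apply: phi_gt0; lia.
move=> le2; rewrite mulrC -(ler_pM2r B0); apply: (le_trans le2).
by rewrite mulrC -expr2 ler_pM2l ?exprn_gt0.
Qed.

End LogConcave.

(** * From the eigenvalue equation to the recurrence *)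

Section Hypercube.

Variables (R : realType) (n : nat).

Let c k : R := Num.sqrt 'C(n, k)%:R.

Lemma natr_mul_sqrt m p :
  m%:R * Num.sqrt p%:R = Num.sqrt (m ^ 2 * p)%:R :> R.
Proof. by rewrite natrM natrX sqrtrM ?exprn_ge0 // sqrtr_sqr ger0_norm. Qed.

(** This and the next identity are [(k+1) 'C(n, k+1) = (n-k) 'C(n, k)] under the root; they turn the
    hopping terms into the integer weights of the recurrence. *)
Lemma hypercube_hopping_up k : (k < n)%N ->
  hypercube_hopping R n k.+1 * c k.+1 = (n%:R - k%:R) * c k.
Proof.
move=> lt_kn; rewrite -natrB 1?ltnW // natr_mul_sqrt -sqrtrM // -natrM subSS.
by rewrite mulnAC mul_bin_left mulnAC.
Qed.

Lemma hypercube_hopping_down k : (k < n)%N ->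
  hypercube_hopping R n k.+1 * c k = k.+1%:R * c k.+1.
Proof.
move=> lt_kn; rewrite natr_mul_sqrt -sqrtrM // -natrM subSS.
by rewrite -mulnA -mul_bin_left mulnA.
Qed.

Lemma mul_hamiltonianE (a : nat -> R) (V : 'I_n.+1 -> R) (u : 'rV[R]_n.+1) k :
  (k <= n)%N ->
  (u *m hamiltonian a V) 0 (inord k) =
    V (inord k) * u 0 (inord k)
    - (if (0 < k)%N then a k * u 0 (inord k.-1) else 0)
    - (if (k < n)%N then a k.+1 * u 0 (inord k.+1) else 0).
Proof.
move=> le_kn; rewrite /hamiltonian mulmxDr mulmxN mul_mx_diag !mxE.
(* Testing [j.+1 == k] rather than [j == k.-1] makes the first sum empty at [k = 0]. *)
have -> : \sum_j u 0 j * hopping_mx n a j (inord k) =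
    \sum_(j < n.+1) ((if (j.+1 == k)%N then a k * u 0 (inord k.-1) else 0) +
      (if (j == k.+1 :> nat)%N then a k.+1 * u 0 (inord k.+1) else 0)).
  apply: eq_bigr => j _; rewrite !mxE inordK // [k == _]eq_sym.
  case: eqP => [jk|_].
    have -> : (j == k.+1 :> nat) = false by lia.
    by rewrite addr0 mulrC -jk /= inord_val.
  by case: eqP => [<-|_]; rewrite ?mulr0 ?add0r // inord_val mulrC.
rewrite big_split /=.
have -> : \sum_(j < n.+1) (if (j.+1 == k)%N then a k * u 0 (inord k.-1) else 0) =
    (if (0 < k)%N then a k * u 0 (inord k.-1) else 0).
  rewrite -big_mkcond; case: k le_kn => [|k] le_kn /=.
    by rewrite big_pred0.
  rewrite (big_pred1 (inord k)) // => j /=.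
  by rewrite -val_eqE /= inordK ?eqSS //; lia.
have -> : \sum_(j < n.+1) (if (j == k.+1 :> nat)%N then a k.+1 * u 0 (inord k.+1) else 0) =
    (if (k < n)%N then a k.+1 * u 0 (inord k.+1) else 0).
  rewrite -big_mkcond; case: ifP => lt_kn.
    rewrite (big_pred1 (inord k.+1)) // => j /=.
    by rewrite -val_eqE /= inordK.
  by rewrite big_pred0 // => j /=; have := ltn_ord j; lia.
by rewrite opprD addrC addrA [u _ _ * _]mulrC.
Qed.

End Hypercube.

Theorem theorem2 (R : realType) (n : nat) (n_ge1 : (1 <= n)%N)
    (V : 'I_n.+1 -> R) (V_convex : convex_seq V)
    (psi : 'rV[R]_n.+1)
    (psi_ground : ground_state (hamiltonian (hypercube_hopping R n) V) psi) :
  ultra_log_concave (fun k : 'I_n.+1 => psi 0 k ^+ 2).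
Proof.
have [lam [_ /eigenspaceP eig _ psi0]] := psi_ground.
pose c k : R := Num.sqrt 'C(n, k)%:R.
have c0 k : (k <= n)%N -> 0 < c k by move=> ?; rewrite sqrtr_gt0 ltr0n bin_gt0.
(* For [k > n] the binomial is 0, so [phi k = 0] by the convention on division. *)
pose phi k := psi 0 (inord k) / c k.
have phi0 k : (k <= n)%N -> 0 < phi k by move=> ?; rewrite divr_gt0 ?c0.
have psiE k : (k <= n)%N -> psi 0 (inord k) = phi k * c k.
  by move=> le_kn; rewrite divfK ?gt_eqF ?c0.
have phi_eq k : (k <= n)%N ->
    k%:R * phi k.-1 + (n%:R - k%:R) * phi k.+1 = (V (inord k) - lam) * phi k.
  move=> le_kn; have := mul_hamiltonianE _ _ (hypercube_hopping R n) V psi _ le_kn.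
  rewrite eig mxE psiE // => eq_k.
  have ck := c0 _ le_kn; apply: (mulIf (lt0r_neq0 ck)).
  (* The eigenvalue equation, solved for the two neighbour terms, which are then matched one by
     one. *)
  have -> : (V (inord k) - lam) * phi k * c k =
      (if (0 < k)%N then hypercube_hopping R n k * psi 0 (inord k.-1) else 0) +
      (if (k < n)%N then hypercube_hopping R n k.+1 * psi 0 (inord k.+1) else 0).
    by lra.
  rewrite mulrDl; congr (_ + _).
    case: k le_kn {eq_k ck} => [|k] le_kn /=; first by rewrite !mul0r.
    by rewrite psiE 1?ltnW // [RHS]mulrCA hypercube_hopping_down // [RHS]mulrCA mulrA.
  case: ltnP => [lt_kn|ge_kn]; last first.
    have -> : k = n by lia.
    by rewrite subrr !mul0r.
  by rewrite psiE // [RHS]mulrCA hypercube_hopping_up // [RHS]mulrCA mulrA.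
have W_convex k : (k.+2 <= n)%N ->
    2 * (V (inord k.+1) - lam) <= (V (inord k.+2) - lam) + (V (inord k) - lam).
  by move=> le_kn; have := V_convex k.+1 le_kn; rewrite /=; lra.
case=> // k /= le_kn.
have sqE m : (m <= n)%N -> psi 0 (inord m) ^+ 2 / 'C(n, m)%:R = phi m ^+ 2.
  by move=> ?; rewrite /phi expr_div_n sqr_sqrtr ?ler0n.
(* The claim is the square of log-concavity of [phi], and both sides are nonnegative before
   squaring. *)
rewrite !sqE; [|lia..]; rewrite -exprMn lerXn2r ?nnegrE ?exprn_ge0 //.
- by rewrite mulr_ge0 // ltW // phi0 //; lia.
- by rewrite ltW // phi0 //; lia.
exact: (log_concave _ _ _ _ phi0 phi_eq W_convex _ le_kn).
Qed.
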